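(* (Recurrent Inversion Formula.) Let $n\ge1$, $z=(z_1,\dots,z_n)$, and let $H(z)\in\mathbb{C}[[z]]^{n}$ with $o(H(z))\ge 1$. Define the sequence $\{N_{[m]}(z)\mid m\ge 1\}$ in $\mathbb{C}[[z]]^n$ recursively by $$N_{[1]}(z)=H(z),\qquad N_{[m]}(z)=\frac{1}{m-1}\sum_{\substack{k+l=m\\ k,l\ge 1}}JN_{[k]}(z)\cdot N_{[l]}(z)\quad (m\ge 2).$$ Then the formal inverse of $F(z)=z-H(z)$ is given by $$G(z)=z+\sum_{m=1}^\infty N_{[m]}(z).$$
   Context: Vectors are column vectors, and $JN$ denotes the Jacobian matrix of $N$ with respect to $z$. For a vector $U=(U_1,\dots,U_n)$ of power series, $o(U)=\min_i o(U_i)$, where $o(U_i)$ is the lowest total degree of a monomial occurring in $U_i$ (with $o(0)=\infty$). The formal inverse of $F$ is the formal map $G\in\mathbb{C}[[z]]^n$ with $F(G(z))=z=G(F(z))$.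
   Formalization: For o(H) = 1 the claim can fail (n = 1, H = z gives F = 0 and a divergent sum), so there the formula is proved whenever the sum converges coefficientwise in C; for o(H) ≥ 2 existence of the sum and the formula are both proved. *)

(* Defs.v *)
From HB Require Import structures.
From mathcomp Require Import all_boot all_order all_algebra.
From mathcomp Require Import complex.
From mathcomp Require Import boolp classical_sets functions reals ereal.
From mathcomp Require Import topology normedtype sequences.
(* The notations of mpoly cannot be loaded together with those of the
   topology files: only the names are imported. *)
From mathcomp Require Import -(notations) mpoly.

Set Implicit Arguments.
Unset Strict Implicit.
Unset Printing Implicit Defensive.

Import Order.TTheory GRing.Theory Num.Theory.
Import numFieldNormedType.Exports.

Local Open Scope ring_scope.

(* [fps n K] is K[[z_1, ..., z_n]]; [fcoef f m] is the coefficient of z^m. *)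
Record fps (n : nat) (K : Type) := Fps { fcoef : multinom n -> K }.

HB.instance Definition _ (n : nat) (K : Type) := [isNew for @fcoef n K].
HB.instance Definition _ (n : nat) (K : choiceType) :=
  [Choice of fps n K by <:].

Lemma fpsP (n : nat) (K : Type) (f g : fps n K) :
  (forall m, fcoef f m = fcoef g m) -> f = g.
Proof. by case: f g => [f] [g] /= fg; congr Fps; apply: funext. Qed.

Section FpsZmod.
Variables (n : nat) (K : zmodType).
Implicit Types f g : fps n K.

Definition fps0 : fps n K := Fps (fun=> 0).
Definition fps_opp f : fps n K := Fps (fun m => - fcoef f m).
Definition fps_add f g : fps n K := Fps (fun m => fcoef f m + fcoef g m).

Fact fps_addA : associative fps_add.
Proof. by move=> f g h; apply: fpsP => m /=; rewrite addrA. Qed.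
Fact fps_addC : commutative fps_add.
Proof. by move=> f g; apply: fpsP => m /=; rewrite addrC. Qed.
Fact fps_add0 : left_id fps0 fps_add.
Proof. by move=> f; apply: fpsP => m /=; rewrite add0r. Qed.
Fact fps_addN : left_inverse fps0 fps_opp fps_add.
Proof. by move=> f; apply: fpsP => m /=; rewrite addNr. Qed.

HB.instance Definition _ := GRing.isZmodule.Build (fps n K)
  fps_addA fps_addC fps_add0 fps_addN.
End FpsZmod.

Section FpsRing.
Variables (n : nat) (K : comNzRingType).
Implicit Types f g h : fps n K.

Definition fps_const (c : K) : fps n K :=
  Fps (fun m => if m == mnm0 then c else 0).

(* Cauchy product; the bounds only serve to make the index type finite *)
Definition fps_mul f g : fps n K := Fps (fun m =>
  \sum_(k : bmultinom n (mdeg m).+1 * bmultinom n (mdeg m).+1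
          | m == mnm_add k.1 k.2) fcoef f k.1 * fcoef g k.2).

(* the polynomial made of the terms of f of degree at most d *)
Definition fps_trunc (d : nat) f : mpoly n K :=
  \sum_(k : bmultinom n d.+1) fcoef f k *: mpolyX K k.

Lemma mcoeff_trunc d f m :
  (mdeg m <= d)%N -> mcoeff m (fps_trunc d f) = fcoef f m.
Proof.
move=> md; have md1 : (mdeg m < d.+1)%N by [].
rewrite /fps_trunc raddf_sum (bigD1 (BMultinom md1)) //= mcoeffZ mcoeffX eqxx.
rewrite mulr1 big1 ?addr0 // => k kNm.
rewrite mcoeffZ mcoeffX (_ : (_ == _) = false) ?mulr0 //.
by apply: contraNF kNm => /eqP km; apply/eqP/val_inj.
Qed.

Lemma mcoeff_mul_eq d (p q p' q' : mpoly n K) :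
    (forall m, (mdeg m <= d)%N -> mcoeff m p = mcoeff m p') ->
    (forall m, (mdeg m <= d)%N -> mcoeff m q = mcoeff m q') ->
  forall m, (mdeg m <= d)%N -> mcoeff m (p * q) = mcoeff m (p' * q').
Proof.
move=> pp' qq' m md; rewrite !mcoeffM; apply: eq_bigr => -[k l] _ /=.
have kd (k' : bmultinom n (mdeg m).+1) : (mdeg k' <= d)%N.
  by apply: leq_trans md; rewrite -ltnS (valP k').
by rewrite pp' ?qq'.
Qed.

Lemma fcoef_mul d f g m : (mdeg m <= d)%N ->
  fcoef (fps_mul f g) m = mcoeff m (fps_trunc d f * fps_trunc d g).
Proof.
move=> md; rewrite mcoeffM /=; apply: eq_bigr => -[k l] _ /=.
have kd (k' : bmultinom n (mdeg m).+1) : (mdeg k' <= d)%N.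
  by apply: leq_trans md; rewrite -ltnS (valP k').
by rewrite !mcoeff_trunc.
Qed.

Fact fps_mulC : commutative fps_mul.
Proof.
by move=> f g; apply: fpsP => m; rewrite !(@fcoef_mul (mdeg m)) // mulrC.
Qed.

Fact fps_mulA : associative fps_mul.
Proof.
move=> f g h; apply: fpsP => m; pose d := mdeg m.
have trM f' g' m' : (mdeg m' <= d)%N -> mcoeff m' (fps_trunc d (fps_mul f' g'))
    = mcoeff m' (fps_trunc d f' * fps_trunc d g').
  by move=> m'd; rewrite mcoeff_trunc // (@fcoef_mul d).
rewrite !(@fcoef_mul d) //.
rewrite (mcoeff_mul_eq (p' := fps_trunc d f) _ (trM g h)) //.
by rewrite mulrA; apply/esym/(mcoeff_mul_eq (trM f g)).
Qed.

Fact fps_mul1 : left_id (fps_const 1) fps_mul.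
Proof.
move=> f; apply: fpsP => m; pose d := mdeg m.
rewrite (@fcoef_mul d) // -(@mcoeff_trunc d f m) //.
rewrite -[in RHS](mul1r (fps_trunc d f)).
apply: (@mcoeff_mul_eq d) => // m' m'd.
by rewrite mcoeff_trunc //= mcoeff1; case: eqP.
Qed.

Fact fps_mulDl : left_distributive fps_mul +%R.
Proof.
move=> f g h; apply: fpsP => m /=; rewrite -big_split /=.
by apply: eq_bigr => k _; rewrite mulrDl.
Qed.

Fact fps_1neq0 : fps_const 1 != 0.
Proof.
apply/eqP => /(congr1 (fun f => fcoef f mnm0)) /=.
by rewrite eqxx; apply/eqP/oner_neq0.
Qed.

HB.instance Definition _ := GRing.Zmodule_isComNzRing.Build (fps n K)
  fps_mulA fps_mulC fps_mul1 fps_mulDl fps_1neq0.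

Definition fps_X (i : 'I_n) : fps n K := Fps (fun m => (m == mnm1 i)%:R).

(* partial derivative with respect to z_i *)
Definition fps_deriv (i : 'I_n) f : fps n K :=
  Fps (fun m => fcoef f (mnm_add m (mnm1 i)) *+ (m i).+1).

(* [fps_subst f g] is f(g_1, ..., g_n). If no g_i has a constant term, then
   the terms f_a g^a with mdeg a > mdeg m do not contribute to the coefficient
   of z^m, so that the sum below is the whole coefficient. *)
Definition fps_subst f (g : 'cV[fps n K]_n) : fps n K := Fps (fun m =>
  \sum_(a : bmultinom n (mdeg m).+1)
     fcoef f a * fcoef (\prod_(i < n) g i 0 ^+ (a : multinom n) i) m).

Definition fps_comp (F G : 'cV[fps n K]_n) : 'cV[fps n K]_n :=
  \col_i fps_subst (F i 0) G.

Definition fps_id : 'cV[fps n K]_n := \col_i fps_X i.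

Definition jacobian (N : 'cV[fps n K]_n) : 'M[fps n K]_n :=
  \matrix_(i, j) fps_deriv j (N i 0).

End FpsRing.

Arguments fps_const {n K} c.
Arguments fps_id {n K}.

Section ComplexFps.
Variables (R : realType) (n : nat).
Local Open Scope complex_scope.
Local Open Scope classical_set_scope.

(* lowest degree of a monomial of f; +oo for f = 0 *)
Definition fps_order (f : fps n R[i]) : \bar R :=
  ereal_inf [set (mdeg m)%:R%:E | m in [set m | fcoef f m != 0]].

Definition vec_order (U : 'cV[fps n R[i]]_n) : \bar R :=
  \big[Order.min/+oo%E]_(i < n) fps_order (U i 0).

(* The order conditions are those under which F(G) and G(F) are given by
   [fps_comp]. *)
Definition is_formal_inverse (F G : 'cV[fps n R[i]]_n) : Prop :=
  [/\ (1 <= vec_order F)%E, (1 <= vec_order G)%E,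
      fps_comp F G = fps_id & fps_comp G F = fps_id].

(* S is the sum of the N m for m >= 1, each coefficient being the sum of a
   convergent series of complex numbers ([R[i]^o] is R[i] with the topology
   of its modulus). *)
Definition is_sum (N : nat -> 'cV[fps n R[i]]_n) (S : 'cV[fps n R[i]]_n) :=
  forall (i : 'I_n) (m : multinom n),
    (fun M : nat => fcoef ((\sum_(1 <= k < M) N k) i 0) m : R[i]^o) @ \oo
      --> (fcoef (S i 0) m : R[i]^o).

(* The same for the discrete topology on the coefficients: the partial sums of
   each coefficient are eventually constant. *)
Definition is_formal_sum (N : nat -> 'cV[fps n R[i]]_n)
    (S : 'cV[fps n R[i]]_n) :=
  forall (i : 'I_n) (m : multinom n),
    \forall M \near \oo,
      fcoef ((\sum_(1 <= k < M) N k) i 0) m = fcoef (S i 0) m.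

End ComplexFps.

(* Main.v *)
(* Introduce a parameter t: over K[[t]] put U = z + t N with
   N = sum_k t^k N_[k+1]. The recurrence says that the derivation
   D = d/dt - sum_j N_j d/dz_j kills N, hence U, hence every power series in U.
   So D kills N - H(U), which vanishes at t = 0, and D is injective on such
   series: N = H(U), that is U - t H(U) = z.
   It remains to put t = 1. The linear part of the identity shows that I - A is
   invertible, where A is the linear part of H. By induction on the degree,
   every coefficient of U is then a rational function of t, with a power of
   det(I - tA) as denominator; for such series summation at t = 1 is compatible
   with products, even if the convergence is only conditional. Hence G = z + S
   satisfies F(G) = z, and G(F) = z follows since F(V) = F(W) implies V = W. *)
Require Import Defs.
From HB Require Import structures.
From mathcomp Require Import all_boot all_order all_algebra.
From mathcomp Require Import complex.
From mathcomp Require Import boolp classical_sets functions reals ereal.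
From mathcomp Require Import topology normedtype sequences.
From mathcomp Require Import -(notations) mpoly.
From mathcomp Require Import ring.

Set Implicit Arguments.
Unset Strict Implicit.
Unset Printing Implicit Defensive.

Import Order.TTheory GRing.Theory Num.Theory.
Import numFieldNormedType.Exports.
Local Open Scope ring_scope.
Local Open Scope complex_scope.

(** * Multi-indices, and coefficients of products and derivatives of power series *)

Lemma mdeg_mnmD n (a b : multinom n) : mdeg (mnm_add a b) = (mdeg a + mdeg b)%N.
Proof. exact: mdegD. Qed.

Lemma mnm_addC n (a b : multinom n) : mnm_add a b = mnm_add b a.
Proof. by apply/mnmP => i; rewrite !mnmDE addnC. Qed.

Lemma big_bmultinom_widen n (V : zmodType) (d e : nat) (F : multinom n -> V) :
    (d <= e)%N -> (forall a, (d <= mdeg a)%N -> F a = 0) ->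
  \sum_(a : bmultinom n e) F a = \sum_(a : bmultinom n d) F a.
Proof.
move=> de F0.
rewrite (bigID (fun a : bmultinom n e => (mdeg a < d)%N)) /=.
rewrite [X in _ + X]big1 ?addr0; last by move=> a; rewrite -leqNgt; apply: F0.
(* No multi-index has degree below 0; for a positive bound, [bm0] serves as the default value of
   [insubd] in the inverse of the inclusion [W]. *)
case: d de F0 => [|d] de F0.
  by rewrite big_pred0 // big1 // => -[].
pose W (a : bmultinom n d.+1) := BMultinom (leq_trans (bmdeg a) de).
rewrite (reindex W) /=; last first.
  exists (insubd (@bm0 n d)) => a Ha.
    exact: (valKd (@bm0 n d) a).
  by apply: val_inj; apply: (insubdK (@bm0 n d) Ha).
by apply: eq_bigl => a /=; rewrite bmdeg.
Qed.

Section Coefficients.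
Variables (n : nat) (K : comNzRingType).
Implicit Types (f g : fps n K) (m : multinom n).

Lemma fcoefD f g m : fcoef (f + g) m = fcoef f m + fcoef g m. Proof. by []. Qed.
Lemma fcoefN f m : fcoef (- f) m = - fcoef f m. Proof. by []. Qed.
Lemma fcoefB f g m : fcoef (f - g) m = fcoef f m - fcoef g m. Proof. by []. Qed.
Lemma fcoef1 m : fcoef (1 : fps n K) m = (m == mnm0)%:R.
Proof. by rewrite [LHS]/=; case: eqP. Qed.

Lemma fcoef_sum I (r : seq I) (P : pred I) (F : I -> fps n K) m :
  fcoef (\sum_(i <- r | P i) F i) m = \sum_(i <- r | P i) fcoef (F i) m.
Proof. by apply: (big_morph (fun f => fcoef f m)). Qed.

Lemma fcoefM f g m : fcoef (f * g) m =
  \sum_(k : bmultinom n (mdeg m).+1 * bmultinom n (mdeg m).+1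
     | m == mnm_add k.1 k.2) fcoef f k.1 * fcoef g k.2.
Proof. by []. Qed.

Lemma fcoefM0 f g : fcoef (f * g) mnm0 = fcoef f mnm0 * fcoef g mnm0.
Proof.
have d0 : (mdeg (mnm0 : multinom n) <= 0)%N by rewrite mdeg0.
rewrite [LHS](@fcoef_mul _ _ 0) // -[in RHS](mcoeff_trunc f d0).
by rewrite -[in RHS](mcoeff_trunc g d0) (rmorphM (mcoeff (mnm0 : multinom n))).
Qed.

Lemma fcoefCM c f m : fcoef (fps_const c * f) m = c * fcoef f m.
Proof.
pose d := mdeg m; rewrite [LHS](@fcoef_mul _ _ d) //.
rewrite (@mcoeff_mul_eq _ _ d _ _ (mpolyC n c) (fps_trunc d f)) //.
  by rewrite mcoeffCM mcoeff_trunc.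
move=> k kd; rewrite mcoeff_trunc //= mcoeffC.
by case: eqP; rewrite ?mulr1 ?mulr0.
Qed.

Fact fps_const_is_zmod_morphism : zmod_morphism (@fps_const n K).
Proof.
by move=> a b; apply: fpsP => m; rewrite /=; case: eqP; rewrite ?subr0.
Qed.
Fact fps_const_is_monoid_morphism : monoid_morphism (@fps_const n K).
Proof.
split=> // a b; apply: fpsP => m; rewrite fcoefCM /=.
by case: eqP; rewrite ?mulr0.
Qed.
HB.instance Definition _ :=
  GRing.isZmodMorphism.Build K (fps n K) (@fps_const n K)
    fps_const_is_zmod_morphism.
HB.instance Definition _ :=
  GRing.isMonoidMorphism.Build K (fps n K) (@fps_const n K)
    fps_const_is_monoid_morphism.

Lemma fcoef_deriv i f m :
  fcoef (fps_deriv i f) m = fcoef f (mnm_add m (mnm1 i)) *+ (m i).+1.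
Proof. by []. Qed.

Lemma fps_derivB i f g : fps_deriv i (f - g) = fps_deriv i f - fps_deriv i g.
Proof. by apply: fpsP => m; rewrite /= mulrnDl mulNrn. Qed.

(** The Leibniz rule is inherited from polynomials. Differentiation lowers the degree by one, so
    that coefficients of degree at most d are read off truncations at degree d + 1. *)
Lemma fps_derivM i f g :
  fps_deriv i (f * g) = fps_deriv i f * g + f * fps_deriv i g.
Proof.
apply: fpsP => m; pose d := mdeg m; pose p := fps_trunc d.+1 f.
pose q := fps_trunc d.+1 g.
have md : (mdeg (mnm_add m (mnm1 i)) <= d.+1)%N by rewrite mdeg_mnmD mdeg1
  addn1.
have pE k : (mdeg k <= d)%N -> mcoeff k p = fcoef f k.
  by move=> kd; rewrite mcoeff_trunc // ltnW.
have qE k : (mdeg k <= d)%N -> mcoeff k q = fcoef g k.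
  by move=> kd; rewrite mcoeff_trunc // ltnW.
have dE (h : fps n K) k : (mdeg k <= d)%N ->
    mcoeff k (mderiv i (fps_trunc d.+1 h)) = fcoef (fps_deriv i h) k.
  by move=> kd; rewrite mcoeff_mderiv mcoeff_trunc // mdeg_mnmD mdeg1 addn1.
rewrite fcoef_deriv [fcoef (f * g) _](@fcoef_mul _ _ d.+1) // -mcoeff_mderiv.
rewrite mderivM mcoeffD fcoefD; congr (_ + _).
  rewrite [RHS](@fcoef_mul _ _ d) //; apply: (@mcoeff_mul_eq _ _ d) => // k kd.
    by rewrite dE // mcoeff_trunc.
  by rewrite qE // mcoeff_trunc.
rewrite [RHS](@fcoef_mul _ _ d) //; apply: (@mcoeff_mul_eq _ _ d) => // k kd.
  by rewrite pE // mcoeff_trunc.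
by rewrite dE // mcoeff_trunc.
Qed.

Lemma fps_derivX (i j : 'I_n) : fps_deriv i (fps_X K j) = (i == j)%:R.
Proof.
apply: fpsP => m; have -> : fcoef ((i == j)%:R : fps n K) m
    = ((i == j) && (m == mnm0))%:R by case: (i == j); rewrite ?fcoef1.
rewrite fcoef_deriv [fcoef _ _]/=; have [<-|ij] := eqVneq i j.
  case: (m =P mnm0) => [->|m0].
    rewrite mnm0E (_ : mnm_add mnm0 _ = mnm1 i) ?eqxx //.
    by apply/mnmP => k; rewrite mnmDE mnm0E.
  rewrite (_ : (_ == _) = false) ?mul0rn //; apply/eqP => e; apply: m0.
  apply/mnmP => k; move/(congr1 (fun x : multinom n => x k)): e.
  by rewrite mnmDE mnm0E -[RHS]add0n => /addIn.
rewrite (_ : (_ == _) = false) ?mul0rn //;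
  apply/eqP => /(congr1 (fun x : multinom n => x i)).
by rewrite mnmDE !mnm1E eqxx eq_sym (negbTE ij) addn1.
Qed.

Lemma fps_deriv_const i c : fps_deriv i (fps_const c : fps n K) = 0.
Proof.
apply: fpsP => m; rewrite fcoef_deriv [fcoef _ _]/= (_ :
  (_ == _) = false) ?mul0rn //.
by apply/eqP => /(congr1 (fun x => mdeg x));
  rewrite mdeg_mnmD mdeg1 addn1 mdeg0.
Qed.

End Coefficients.

(** * Coefficientwise relations *)

(* The relations of interest are equality, evaluation at t = 0 and summation at
   t = 1: each lemma below is used for several of them. *)
Record subring_rel (A B : comNzRingType) (rho : A -> B -> Prop) : Prop := {
  rel1 : rho 1 1;
  relB : forall a b a' b', rho a a' -> rho b b' -> rho (a - b) (a' - b');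
  relM : forall a b a' b', rho a a' -> rho b b' -> rho (a * b) (a' * b') }.

Section SubringRel.
Variables (A B : comNzRingType) (rho : A -> B -> Prop).
Hypothesis rhoP : subring_rel rho.

Lemma rel0 : rho 0 0.
Proof. by rewrite -(subrr 1) -[0 in X in rho _ X](subrr 1); do 2?case: rhoP;
  auto. Qed.

Lemma relN a a' : rho a a' -> rho (- a) (- a').
Proof. by rewrite -[- a]add0r -[- a']add0r; apply: (relB rhoP);
  apply: rel0. Qed.

Lemma relD a b a' b' : rho a a' -> rho b b' -> rho (a + b) (a' + b').
Proof.
by move=> ra /relN rb; rewrite -[b]opprK -[b']opprK; apply: (relB rhoP).
Qed.

Lemma rel_sum I (r : seq I) (P : pred I) F G :
    (forall i, P i -> rho (F i) (G i)) ->
  rho (\sum_(i <- r | P i) F i) (\sum_(i <- r | P i) G i).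
Proof. by move=> FG; apply: big_ind2 => //; [exact: rel0 | by move=> *;
  apply: relD]. Qed.

Lemma rel_prod I (r : seq I) (P : pred I) F G :
    (forall i, P i -> rho (F i) (G i)) ->
  rho (\prod_(i <- r | P i) F i) (\prod_(i <- r | P i) G i).
Proof. by move=> FG; apply: big_ind2 => //; [exact: rel1 | by move=> *;
  apply: (relM rhoP)]. Qed.

Lemma relX a a' k : rho a a' -> rho (a ^+ k) (a' ^+ k).
Proof.
move=> ra; elim: k => [|k IHk]; first by rewrite !expr0; apply: rel1.
by rewrite !exprS; apply: relM.
Qed.

Lemma rel_det p (M : 'M[A]_p) (M' : 'M[B]_p) :
  (forall i j, rho (M i j) (M' i j)) -> rho (\det M) (\det M').
Proof.
move=> rM; rewrite /determinant; apply: rel_sum => s _; apply: relM => //.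
  by apply: relX; apply: relN; apply: rel1.
by apply: rel_prod.
Qed.

Lemma rel_adj p (M : 'M[A]_p) (M' : 'M[B]_p) :
  (forall i j, rho (M i j) (M' i j)) ->
  forall i j, rho ((\adj M) i j) ((\adj M') i j).
Proof.
move=> rM i j; rewrite !mxE; apply: (relM rhoP).
  by apply: relX; apply: relN; apply: rel1.
by apply: rel_det => k l; rewrite !mxE.
Qed.

Variable n : nat.

Definition coef_rel (d : nat) (f : fps n A) (g : fps n B) : Prop :=
  forall m, (mdeg m < d)%N -> rho (fcoef f m) (fcoef g m).

Lemma coef_relM d f g f' g' : coef_rel d f f' -> coef_rel d g g' ->
  coef_rel d (f * g) (f' * g').
Proof.
move=> rf rg m md; rewrite !fcoefM; apply: rel_sum => -[k l] /= /eqP mkl.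
have {}md : (mdeg k + mdeg l < d)%N by rewrite -mdeg_mnmD -mkl.
by apply: (relM rhoP); [apply: rf | apply: rg]; apply: leq_ltn_trans md;
  rewrite ?leq_addr ?leq_addl.
Qed.

(** A product of terms of total degree at most d that are both non-constant has both factors of
    degree less than d; the terms with a constant factor vanish on both sides. *)
Lemma coef_relM_lift d f g f' g' :
    fcoef f mnm0 = 0 -> fcoef f' mnm0 = 0 ->
    fcoef g mnm0 = 0 -> fcoef g' mnm0 = 0 ->
    coef_rel d f f' -> coef_rel d g g' ->
  coef_rel d.+1 (f * g) (f' * g').
Proof.
move=> f0 f'0 g0 g'0 rf rg m md; rewrite !fcoefM.
apply: rel_sum => -[k l] /= /eqP mkl.
have [k0|k0] := eqVneq (bmnm k) mnm0.
  by rewrite k0 f0 f'0 !mul0r; apply: rel0.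
have [l0|l0] := eqVneq (bmnm l) mnm0.
  by rewrite l0 g0 g'0 !mulr0; apply: rel0.
have {}md : (mdeg k + mdeg l <= d)%N by rewrite -mdeg_mnmD -mkl.
rewrite -mdeg_eq0 -lt0n in k0; rewrite -mdeg_eq0 -lt0n in l0.
apply: (relM rhoP); [apply: rf | apply: rg]; apply: leq_trans md.
  by rewrite -addn1 leq_add2l.
by rewrite -add1n leq_add2r.
Qed.

Lemma coef_rel1 d : coef_rel d 1 1.
Proof.
move=> m _; rewrite !fcoef1.
by case: (m == _); [apply: rel1 | apply: rel0].
Qed.

Lemma coef_rel_prod d I (r : seq I) F G : (forall i, coef_rel d (F i) (G i)) ->
  coef_rel d (\prod_(i <- r) F i) (\prod_(i <- r) G i).
Proof.
move=> FG; apply: (big_ind2 (coef_rel d)) => //; first exact: coef_rel1.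
by move=> *; apply: coef_relM.
Qed.

Lemma coef_relX d f g k : coef_rel d f g -> coef_rel d (f ^+ k) (g ^+ k).
Proof.
move=> fg; elim: k => [|k IHk]; first by rewrite !expr0; apply: coef_rel1.
by rewrite !exprS; apply: coef_relM.
Qed.

End SubringRel.

Lemma eq_subring_rel (A : comNzRingType) : subring_rel (@eq A).
Proof. by split=> // a b a' b' -> ->. Qed.

Lemma mnm_split n (a : multinom n) : (0 < mdeg a)%N ->
  exists i b, a = mnm_add (mnm1 i) b.
Proof.
rewrite mdegE => a0; have [i ai] : exists i, (0 < a i)%N.
  apply/existsP; apply: contraTT a0; rewrite negb_exists => /forallP a0.
  by rewrite big1 // => i _; move: (a0 i); rewrite lt0n negbK => /eqP.
exists i, (mnm_sub a (mnm1 i)); apply/mnmP => j; rewrite mnmDE mnmBE mnm1E.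
by rewrite subnKC //; case: eqP => // <-.
Qed.

(** * Substitution *)

Section Monomials.
Variables (n : nat) (K : comNzRingType).
Implicit Types (f : fps n K) (g : 'cV[fps n K]_n) (a b m : multinom n).

Definition no_const g : Prop := forall i, fcoef (g i 0) mnm0 = 0.

Definition fps_mono g a : fps n K := \prod_(i < n) g i 0 ^+ a i.

Lemma fps_mono1 g i : fps_mono g (mnm1 i) = g i 0.
Proof. exact: (mmap1U (fun i => g i 0) i). Qed.

Lemma fps_monoD g a b : fps_mono g (mnm_add a b) = fps_mono g a * fps_mono g b.
Proof.
by rewrite /fps_mono -big_split; apply: eq_bigr => i _; rewrite mnmDE exprD.
Qed.

Lemma fcoefM_vanish d e f1 f2 :
    (forall m, (mdeg m < d)%N -> fcoef f1 m = 0) ->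
    (forall m, (mdeg m < e)%N -> fcoef f2 m = 0) ->
  forall m, (mdeg m < d + e)%N -> fcoef (f1 * f2) m = 0.
Proof.
move=> f1d f2e m md; rewrite fcoefM big1 // => -[k l] /= /eqP mkl.
have {}md : (mdeg k + mdeg l < d + e)%N by rewrite -mdeg_mnmD -mkl.
have [kd|kd] := ltnP (mdeg k) d; first by rewrite f1d ?mul0r.
rewrite f2e ?mulr0 // -(ltn_add2l d); apply: leq_ltn_trans md.
by rewrite leq_add2r.
Qed.

Lemma fcoef_mono_vanish g a m : no_const g -> (mdeg m < mdeg a)%N ->
  fcoef (fps_mono g a) m = 0.
Proof.
move=> g0; pose P f d := forall m, (mdeg m < d)%N -> fcoef f m = 0.
suff: P (fps_mono g a) (\sum_i a i)%N by rewrite -mdegE; apply.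
(* The product of the powers and the sum of the exponents are treated in parallel: lower bounds on
   the order add up under products. *)
apply: (big_ind2 P) => //.
  by move=> f1 d1 f2 d2; apply: fcoefM_vanish.
move=> i _; elim: (a i) => [|k IHk] {}m //; rewrite exprS.
apply: (@fcoefM_vanish 1 k) => // {}m; rewrite ltnS leqn0 mdeg_eq0 => /eqP ->.
exact: g0.
Qed.

End Monomials.

Lemma coef_rel_mono (n : nat) (A B : comNzRingType) (rho : A -> B -> Prop)
    (rhoP : subring_rel rho) d (g : 'cV[fps n A]_n) (g' : 'cV[fps n B]_n) a :
  (forall i, coef_rel rho d (g i 0) (g' i 0)) ->
  coef_rel rho d (fps_mono g a) (fps_mono g' a).
Proof. by move=> rg; apply: coef_rel_prod => // i; apply: coef_relX. Qed.

(* A monomial of degree at least 2 in series without constant term has, in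
   degree d, a coefficient that only depends on those of degree < d. *)
Lemma coef_rel_mono_lift (n : nat) (A B : comNzRingType) (rho : A -> B -> Prop)
    (rhoP : subring_rel rho) d (g : 'cV[fps n A]_n) (g' : 'cV[fps n B]_n) a :
  (1 < mdeg a)%N -> no_const g -> no_const g' ->
  (forall i, coef_rel rho d (g i 0) (g' i 0)) ->
  coef_rel rho d.+1 (fps_mono g a) (fps_mono g' a).
Proof.
move=> a1 g0 g'0 rg; have [i [b ab]] := mnm_split (ltnW a1).
move: a1; rewrite ab mdeg_mnmD mdeg1 ltnS => b0.
rewrite !fps_monoD !fps_mono1; apply: coef_relM_lift => //.
- by apply: fcoef_mono_vanish; rewrite ?mdeg0.
- by apply: fcoef_mono_vanish; rewrite ?mdeg0.
- exact: coef_rel_mono.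
Qed.

Section Substitution.
Variables (n : nat) (K : comNzRingType).
Implicit Types (f : fps n K) (g h : 'cV[fps n K]_n) (a b m : multinom n).

Lemma fcoef_subst f g m : fcoef (fps_subst f g) m =
  \sum_(a : bmultinom n (mdeg m).+1) fcoef f a * fcoef (fps_mono g a) m.
Proof. by []. Qed.

(** This is the bridge to polynomials. In a fixed degree only a truncation of f matters, and on
    polynomials substitution is the ring morphism [mmap], whose laws thus pass to [fps_subst]. *)
Lemma fcoef_subst_mmap f g m (p : mpoly n K) : no_const g ->
    (forall a, (mdeg a <= mdeg m)%N -> mcoeff a p = fcoef f a) ->
  fcoef (fps_subst f g) m =
  fcoef (mmap (@fps_const n K) (fun i => g i 0) p) m.
Proof.
(* The bound must exceed the degrees in p to expand [mmap], and be at least the bound used in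
   [fps_subst]; the additional terms vanish because g has no constant term. *)
move=> g0 pf; pose k := maxn (msize p) (mdeg m).+1.
rewrite (@mmapE _ _ _ _ _ p k) ?leq_maxl // fcoef_sum fcoef_subst.
pose F a := mcoeff a p * fcoef (fps_mono g a) m.
rewrite [RHS](eq_bigr (fun a : bmultinom n k => F a)); last first.
  by move=> a _; rewrite fcoefCM.
rewrite (big_bmultinom_widen (d := (mdeg m).+1)) ?leq_maxr //; last first.
  by move=> a ma; rewrite /F fcoef_mono_vanish ?mulr0.
by apply: eq_bigr => a _; rewrite /F pf // -ltnS bmdeg.
Qed.

Lemma fps_substD f1 f2 g :
  fps_subst (f1 + f2) g = fps_subst f1 g + fps_subst f2 g.
Proof.
apply: fpsP => m; rewrite fcoefD !fcoef_subst -big_split.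
by apply: eq_bigr => a _; rewrite fcoefD mulrDl.
Qed.

Lemma fps_substB f1 f2 g :
  fps_subst (f1 - f2) g = fps_subst f1 g - fps_subst f2 g.
Proof.
apply: fpsP => m; rewrite fcoefB !fcoef_subst -sumrB.
by apply: eq_bigr => a _; rewrite fcoefB mulrBl.
Qed.

Lemma fps_subst0 g : fps_subst 0 g = 0.
Proof. by have := fps_substB 0 0 g; rewrite !subrr. Qed.

Lemma fps_subst_sum I (r : seq I) (P : pred I) (F : I -> fps n K) g :
  fps_subst (\sum_(i <- r | P i) F i) g = \sum_(i <- r | P i) fps_subst (F i) g.
Proof.
apply: (big_morph (fun f => fps_subst f g)) => [f1 f2|].
  exact: fps_substD.
exact: fps_subst0.
Qed.

Lemma fps_subst_const c g : no_const g -> fps_subst (fps_const c) g =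
  fps_const c.
Proof.
move=> g0; apply: fpsP => m; rewrite (fcoef_subst_mmap (p := mpolyC n c)) //.
  by rewrite mmapC.
by move=> a _; rewrite mcoeffC /=; case: eqP; rewrite ?mulr1 ?mulr0.
Qed.

Lemma fps_subst_X i g : no_const g -> fps_subst (fps_X K i) g = g i 0.
Proof.
move=> g0; apply: fpsP => m.
rewrite (fcoef_subst_mmap (p := mpolyX K (mnm1 i))) //.
  by rewrite mmapX mmap1U.
by move=> a _; rewrite mcoeffX eq_sym.
Qed.

(** The product of the truncations of the factors has the coefficients of f1 * f2 up to the degree
    of m, and [mmap] is multiplicative. *)
Lemma fps_substM f1 f2 g : no_const g ->
  fps_subst (f1 * f2) g = fps_subst f1 g * fps_subst f2 g.
Proof.
move=> g0; apply: fpsP => m; pose d := mdeg m.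
rewrite (fcoef_subst_mmap (p := fps_trunc d f1 * fps_trunc d f2)) //;
  last first.
  by move=> a ad; rewrite [RHS](@fcoef_mul _ _ d).
rewrite rmorphM; apply/esym.
apply: (@coef_relM _ _ _ (eq_subring_rel K) n d.+1) => // k kd;
  by apply: fcoef_subst_mmap => // a ak; rewrite mcoeff_trunc // (leq_trans ak).
Qed.

Lemma fps_subst_mono a g h : no_const h ->
  fps_subst (fps_mono g a) h = fps_mono (fps_comp g h) a.
Proof.
move=> h0; rewrite /fps_mono.
have s1 : fps_subst 1 h = 1 by apply: fps_subst_const.
rewrite (big_morph (fun f => fps_subst f h) (fun f1 f2 => fps_substM f1 f2 h0)
  s1).
apply: eq_bigr => i _; rewrite mxE; elim: (a i) => [|k IHk].
  by rewrite !expr0.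
by rewrite !exprS fps_substM // IHk.
Qed.

Lemma fps_subst_mmap (p : mpoly n K) g h : no_const h ->
  fps_subst (mmap (@fps_const n K) (fun i => g i 0) p) h =
  mmap (@fps_const n K) (fun i => fps_comp g h i 0) p.
Proof.
move=> h0; rewrite /mmap fps_subst_sum; apply: eq_bigr => a _.
by rewrite fps_substM // fps_subst_const // fps_subst_mono.
Qed.

Lemma fcoef_subst0 f g : no_const g -> fcoef (fps_subst f g) mnm0 = fcoef f
  mnm0.
Proof.
move=> g0; rewrite (fcoef_subst_mmap (p := mpolyC n (fcoef f mnm0))) //.
  by rewrite mmapC /= eqxx.
move=> a; rewrite mdeg0 leqn0 mdeg_eq0 => /eqP ->.
by rewrite mcoeffC eqxx mulr1.
Qed.

Lemma no_const_comp g h : no_const g -> no_const h -> no_const (fps_comp g h).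
Proof. by move=> g0 h0 i; rewrite mxE fcoef_subst0. Qed.

Lemma no_const_id : no_const (fps_id : 'cV[fps n K]_n).
Proof.
move=> i; rewrite mxE /= (_ : (_ == _) = false) //.
by rewrite eq_sym -mdeg_eq0 mdeg1.
Qed.

End Substitution.

Lemma coef_rel_subst (n : nat) (A B : comNzRingType) (rho : A -> B -> Prop)
    (rhoP : subring_rel rho) d (f : fps n A) (f' : fps n B)
    (g : 'cV[fps n A]_n) (g' : 'cV[fps n B]_n) :
  coef_rel rho d f f' -> (forall i, coef_rel rho d (g i 0) (g' i 0)) ->
  coef_rel rho d (fps_subst f g) (fps_subst f' g').
Proof.
move=> rf rg m md; rewrite !fcoef_subst; apply: rel_sum => // a _.
apply: (relM rhoP); last exact: coef_rel_mono.
by apply: rf; apply: leq_ltn_trans md; rewrite -ltnS bmdeg.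
Qed.

(** For a polynomial f this is [fps_subst_mmap]. Up to the degree of m, f may be replaced by its
    truncation on both sides, since substitution preserves agreement up to a given degree. *)
Lemma fps_substA (n : nat) (K : comNzRingType) (f : fps n K)
    (g h : 'cV[fps n K]_n) : no_const g -> no_const h ->
  fps_subst (fps_subst f g) h = fps_subst f (fps_comp g h).
Proof.
move=> g0 h0; apply: fpsP => m; pose d := mdeg m; pose p := fps_trunc d f.
rewrite [RHS](@fcoef_subst_mmap _ _ _ _ _ p); last 2 first.
- exact: no_const_comp.
- by move=> a ad; rewrite mcoeff_trunc.
rewrite -fps_subst_mmap //.
apply: (@coef_rel_subst _ _ _ _ (eq_subring_rel K) d.+1) => // k kd.
by apply: fcoef_subst_mmap => // a ak; rewrite mcoeff_trunc // (leq_trans ak).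
Qed.

Lemma fps_compA (n : nat) (K : comNzRingType) (f g h : 'cV[fps n K]_n) :
  no_const g -> no_const h ->
  fps_comp (fps_comp f g) h = fps_comp f (fps_comp g h).
Proof.
by move=> g0 h0; apply/colP => i; rewrite !mxE fps_substA.
Qed.

(** * Polynomials as power series, and the identity map *)

Section Polynomials.
Variables (n : nat) (K : comNzRingType).

Definition fps_of_mpoly (p : mpoly n K) : fps n K := Fps (fun m => mcoeff m p).

Fact fps_of_mpoly_is_zmod_morphism : zmod_morphism fps_of_mpoly.
Proof. by move=> p q; apply: fpsP => m; rewrite /= mcoeffB. Qed.
Fact fps_of_mpoly_is_monoid_morphism : monoid_morphism fps_of_mpoly.
Proof.
split; first by apply: fpsP => m; rewrite fcoef1 /= mcoeff1.
by move=> p q; apply: fpsP => m; rewrite [LHS]/= mcoeffM.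
Qed.
HB.instance Definition _ :=
  GRing.isZmodMorphism.Build (mpoly n K) (fps n K) fps_of_mpoly
    fps_of_mpoly_is_zmod_morphism.
HB.instance Definition _ :=
  GRing.isMonoidMorphism.Build (mpoly n K) (fps n K) fps_of_mpoly
    fps_of_mpoly_is_monoid_morphism.

Lemma fcoef_mono_id a m :
  fcoef (fps_mono (fps_id : 'cV[fps n K]_n) a) m = (m == a)%:R.
Proof.
suff -> : fps_mono fps_id a = fps_of_mpoly (mpolyX K a).
  by rewrite /= mcoeffX eq_sym.
rewrite mpolyXE_id rmorph_prod; apply: eq_bigr => i _; rewrite rmorphXn mxE.
by congr (_ ^+ _); apply: fpsP => k; rewrite /= mcoeffX eq_sym.
Qed.

Lemma fps_subst_id (f : fps n K) : fps_subst f fps_id = f.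
Proof.
apply: fpsP => m; rewrite fcoef_subst.
rewrite (bigD1 (BMultinom (ltnSn (mdeg m)))) //= fcoef_mono_id eqxx mulr1.
rewrite big1 ?addr0 // => a am;
  rewrite fcoef_mono_id (_ : (_ == _) = false) ?mulr0 //.
by apply: contraNF am => /eqP ma; apply/eqP/val_inj.
Qed.

Lemma fps_comp_id (g : 'cV[fps n K]_n) : fps_comp g fps_id = g.
Proof. by apply/colP => i; rewrite mxE fps_subst_id. Qed.

Lemma fps_comp_idl (g : 'cV[fps n K]_n) : no_const g -> fps_comp fps_id g = g.
Proof. by move=> g0; apply/colP => i; rewrite !mxE fps_subst_X. Qed.

End Polynomials.

(** * Separation of the linear part *)

Section LinearPart.
Variables (n : nat) (K : comNzRingType).
Implicit Types (f : fps n K) (g : 'cV[fps n K]_n).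

Definition fps_nonlinear f : fps n K :=
  Fps (fun m => if (mdeg m < 2)%N then 0 else fcoef f m).

Lemma fps_subst_linear_part f g : no_const g -> fcoef f mnm0 = 0 ->
  fps_subst f g = \sum_j fps_const (fcoef f (mnm1 j)) * g j 0
                  + fps_subst (fps_nonlinear f) g.
Proof.
move=> g0 f0.
have {1}-> : f = \sum_j fps_const (fcoef f (mnm1 j)) * fps_X K j
              + fps_nonlinear f.
  apply: fpsP => m; rewrite fcoefD fcoef_sum [fcoef (fps_nonlinear f) m]/=.
  under eq_bigr do rewrite fcoefCM /=.
  case: ltnP => [m2|m2]; last first.
    rewrite big1 ?add0r // => j _; rewrite (_ : (_ == _) = false) ?mulr0 //.
    by apply: contraTF m2 => /eqP ->; rewrite mdeg1.
  rewrite addr0; have [->|m0] := eqVneq m mnm0.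
    by rewrite f0 big1 // => j _; rewrite eq_sym mnm1_eq0 mulr0.
  have /mdeg1P[i /eqP ->] : mdeg m == 1%N.
    by rewrite eqn_leq -ltnS m2 lt0n mdeg_eq0.
  rewrite (bigD1 i) //= eqxx mulr1 big1 ?addr0 // => j ji.
  by rewrite eq_mnm1 eq_sym (negbTE ji) mulr0.
rewrite fps_substD fps_subst_sum; congr (_ + _); apply: eq_bigr => j _.
by rewrite fps_substM // fps_subst_const // fps_subst_X.
Qed.

End LinearPart.

(** This drives the inductions on the degree: the coefficients of degree d of g enter those of f(g)
    only through the linear part of f, so the nonlinear part gains one degree. *)
Lemma coef_rel_subst_nonlinear (n : nat) (A B : comNzRingType)
    (rho : A -> B -> Prop) (rhoP : subring_rel rho) d
    (f : fps n A) (f' : fps n B) (g : 'cV[fps n A]_n) (g' : 'cV[fps n B]_n) :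
  (forall m, rho (fcoef f m) (fcoef f' m)) -> no_const g -> no_const g' ->
  (forall i, coef_rel rho d (g i 0) (g' i 0)) ->
  coef_rel rho d.+1 (fps_subst (fps_nonlinear f) g)
                    (fps_subst (fps_nonlinear f') g').
Proof.
move=> rf g0 g'0 rg m md; rewrite !fcoef_subst; apply: rel_sum => // a _ /=.
case: ltnP => [_|a2]; first by rewrite !mul0r; apply: rel0.
by apply: (relM rhoP) => //; apply: coef_rel_mono_lift.
Qed.

(** * The deformation parameter *)

Section DerivationInstance.
Variables (n : nat) (K : comNzRingType) (i : 'I_n).

Fact fps_deriv_is_zmod_morphism : zmod_morphism (@fps_deriv n K i).
Proof. exact: fps_derivB. Qed.
HB.instance Definition _ :=
  GRing.isZmodMorphism.Build (fps n K) (fps n K) (@fps_deriv n K i)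
    fps_deriv_is_zmod_morphism.

End DerivationInstance.

Lemma fps_deriv_nat (n : nat) (K : comNzRingType) (i : 'I_n) (b : bool) :
  fps_deriv i (b%:R : fps n K) = 0.
Proof. by rewrite -(rmorph_nat (@fps_const n K)) fps_deriv_const. Qed.

(* The ring K[[z]][[t]] is encoded as K[[t]][[z]], that is
   [fps n (fps 1 K)]. *)
Section Slices.
Variables (n : nat) (K : comNzRingType).
Implicit Types (f g : fps n (fps 1 K)) (c : multinom 1).

Definition tslice c f : fps n K := Fps (fun m => fcoef (fcoef f m) c).

Lemma tslice_sum I (r : seq I) (P : pred I) (F : I -> fps n (fps 1 K)) c :
  tslice c (\sum_(i <- r | P i) F i) = \sum_(i <- r | P i) tslice c (F i).
Proof. by apply: (big_morph (tslice c)) => // *; apply: fpsP. Qed.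

Lemma tsliceB c f g : tslice c (f - g) = tslice c f - tslice c g.
Proof. exact: fpsP. Qed.

Lemma tsliceM c f g : tslice c (f * g) =
  \sum_(k : bmultinom 1 (mdeg c).+1 * bmultinom 1 (mdeg c).+1
     | c == mnm_add k.1 k.2) tslice k.1 f * tslice k.2 g.
Proof.
apply: fpsP => m; rewrite fcoef_sum -[LHS]/(fcoef (fcoef (f * g) m) c).
rewrite fcoefM fcoef_sum; under eq_bigr do rewrite fcoefM.
by rewrite exchange_big; apply: eq_bigr => k _; rewrite fcoefM.
Qed.

Lemma tslice_deriv c j f : tslice c (fps_deriv j f) = fps_deriv j (tslice c f).
Proof.
apply: fpsP => m; rewrite /=; elim: (m j).+1 => [|k IHk] //.
by rewrite !mulrS fcoefD IHk.
Qed.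

Definition tconst (f : fps n K) : fps n (fps 1 K) :=
  Fps (fun m => fps_const (fcoef f m)).

Definition tvar : fps n (fps 1 K) := fps_const (fps_X K ord0).

Definition tderiv f : fps n (fps 1 K) :=
  Fps (fun m => fps_deriv ord0 (fcoef f m)).

Lemma tderivB f g : tderiv (f - g) = tderiv f - tderiv g.
Proof. by apply: fpsP => m; rewrite /= raddfB. Qed.

Lemma tderivM f g : tderiv (f * g) = tderiv f * g + f * tderiv g.
Proof.
apply: fpsP => m; rewrite fcoefD !fcoefM -[LHS]/(fps_deriv ord0 (fcoef (f * g)
  m)) fcoefM raddf_sum.
by rewrite -big_split; apply: eq_bigr => k _ /=; rewrite fps_derivM.
Qed.

Lemma tderiv_const (a : fps 1 K) :
  tderiv (fps_const a) = fps_const (fps_deriv ord0 a).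
Proof. by apply: fpsP => m /=; case: eqP; rewrite ?raddf0. Qed.

End Slices.

Arguments tvar {n K}.

Section TransportDerivation.
Variables (n : nat) (K : comNzRingType) (M : 'cV[fps n (fps 1 K)]_n).
Implicit Types f g : fps n (fps 1 K).

(** For [M := genfun N] this is the derivation D of the overview. *)
Definition transport f := tderiv f - \sum_j M j 0 * fps_deriv j f.

Fact transport_is_zmod_morphism : zmod_morphism transport.
Proof.
move=> f g; rewrite /transport tderivB.
under eq_bigr do rewrite raddfB mulrBr.
rewrite sumrB !opprB addrACA [RHS]addrACA; congr (_ + _); exact: addrC.
Qed.
HB.instance Definition _ :=
  GRing.isZmodMorphism.Build (fps n (fps 1 K)) (fps n (fps 1 K)) transport
    transport_is_zmod_morphism.

Lemma transportM f g : transport (f * g) = transport f * g + f * transport g.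
Proof.
rewrite /transport tderivM.
under eq_bigr do rewrite fps_derivM mulrDr mulrA [M _ _ * (f * _)]mulrCA.
rewrite big_split /= -mulr_suml -mulr_sumr mulrBl mulrBr opprD.
by rewrite addrACA.
Qed.

Lemma transport_const a :
  transport (fps_const a) = fps_const (fps_deriv ord0 a).
Proof.
rewrite /transport tderiv_const big1 ?subr0 // => j _.
by rewrite fps_deriv_const mulr0.
Qed.

Lemma transport_X i : transport (fps_X _ i) = - M i 0.
Proof.
rewrite /transport (_ : tderiv _ = 0) ?sub0r; last first.
  by apply: fpsP => m; rewrite /= fps_deriv_nat.
rewrite (bigD1 i) //= fps_derivX eqxx mulr1 big1 ?addr0 // => j ji.
by rewrite fps_derivX (negbTE ji) mulr0.
Qed.

Lemma transport_mono (U : 'cV[fps n (fps 1 K)]_n) a :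
  (forall i, transport (U i 0) = 0) -> transport (fps_mono U a) = 0.
Proof.
have t1 : transport 1 = 0.
  by rewrite -[1](rmorph1 (@fps_const n _)) transport_const -(rmorph1
    (@fps_const 1 _)) fps_deriv_const raddf0.
have tM f g : transport f = 0 -> transport g = 0 -> transport (f * g) = 0.
  by move=> f0 g0; rewrite transportM f0 g0 mul0r mulr0 addr0.
move=> U0; pose P f := transport f = 0.
apply: (@big_ind _ P) => [||i _]; [exact: t1 | exact: tM |].
elim: (a i) => [|k IHk]; first by rewrite expr0.
by rewrite exprS; apply: tM.
Qed.

Hypothesis M0 : no_const M.

(** The degree lost by a partial derivative in z is regained by multiplication with [M j 0], which
    has no constant term; the derivative in t acts on each coefficient separately. *)
Lemma transport_vanish d f : (forall m, (mdeg m < d)%N -> fcoef f m = 0) ->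
  forall m, (mdeg m < d)%N -> fcoef (transport f) m = 0.
Proof.
case: d => // d fd m md; rewrite fcoefB [fcoef (tderiv f) m]/= fd // raddf0.
rewrite sub0r fcoef_sum big1 ?oppr0 // => j _.
apply: (@fcoefM_vanish _ _ 1 d) => // {md}m md.
  by move: md; rewrite ltnS leqn0 mdeg_eq0 => /eqP ->.
by rewrite fcoef_deriv fd ?mul0rn // mdeg_mnmD mdeg1 addn1.
Qed.

(** Only a chain rule for polynomials is required: the coefficient of z^m is unchanged when H is
    truncated at degree d, by [transport_vanish] applied to the difference. The truncation gives a
    finite sum of monomials in U with coefficients constant in t, and each of them is killed. *)
Lemma transport_subst (H : fps n K) (U : 'cV[fps n (fps 1 K)]_n) :
    no_const U -> (forall i, transport (U i 0) = 0) ->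
  transport (fps_subst (tconst H) U) = 0.
Proof.
move=> U0 tU; apply: fpsP => m; pose d := mdeg m.
pose p := fps_trunc d (tconst H).
pose P := mmap (@fps_const n _) (fun i => U i 0) p.
have -> : fps_subst (tconst H) U = (fps_subst (tconst H) U - P) + P.
  by rewrite subrK.
rewrite raddfD fcoefD (@transport_vanish d.+1) ?add0r //; last first.
  move=> k kd; rewrite fcoefB (@fcoef_subst_mmap _ _ _ _ _ p) ?subrr //.
  by move=> a ak; rewrite mcoeff_trunc // (leq_trans ak).
suff tP : transport P = 0 by apply: (congr1 (fun f => fcoef f m) tP).
have -> : P = \sum_(a : bmultinom n d.+1)
    fps_const (fps_const (fcoef H a)) * fps_mono U a.
  by rewrite /P raddf_sum; apply: eq_bigr => a _; rewrite /= mmapZ mmapX.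
rewrite raddf_sum big1 // => a _ /=.
rewrite transportM transport_mono // mulr0.
by rewrite transport_const fps_deriv_const raddf0 mul0r addr0.
Qed.

End TransportDerivation.

(** Induction on the exponent of t. If the slices of W up to t^b vanish, then the coefficient of t^b
    in [transport M W] is b + 1 times the slice of W at t^(b+1), and b + 1 is nonzero in K. *)
Lemma transport_inj0 (n : nat) (K : numFieldType)
    (M : 'cV[fps n (fps 1 K)]_n) (W : fps n (fps 1 K)) :
  transport M W = 0 -> tslice mnm0 W = 0 -> W = 0.
Proof.
move=> tW W0; suff W00 k c : (mdeg c < k)%N -> tslice c W = 0.
  apply: fpsP => m; apply: fpsP => c.
  by have /(congr1 (fun f => fcoef f m)) := W00 _ _ (ltnSn (mdeg c)).
elim: k c => // k IHk c ck; have [c0|c0] := posnP (mdeg c).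
  by move/eqP: c0; rewrite mdeg_eq0 => /eqP ->.
have [i [b cb]] := mnm_split c0; rewrite (ord1 i) in cb.
have bk : (mdeg b < k)%N by move: ck; rewrite cb mdeg_mnmD mdeg1.
have : tslice b (transport M W) = 0 by rewrite tW; apply: fpsP.
rewrite tsliceB tslice_sum [X in _ - X]big1 ?subr0.
  move=> h; apply: fpsP => m.
  have /(congr1 (fun f => fcoef f m)) /eqP := h.
  rewrite [fcoef _ _]/= mulrn_eq0 /= => /eqP.
  by rewrite cb mnm_addC.
move=> j _; rewrite tsliceM big1 // => -[a1 a2] /= /eqP ba.
rewrite tslice_deriv IHk ?raddf0 ?mulr0 //.
by apply: leq_trans bk; rewrite bmdeg.
Qed.

Lemma mdeg_inj1 : injective (@mdeg 1).
Proof.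
by move=> a b; rewrite !mdegE !big_ord1 => ab; apply/mnmP => i; rewrite ord1.
Qed.

Lemma mdeg_mulmn1 j : mdeg (mnm_muln (mnm1 (@ord0 0)) j) = j.
Proof. by rewrite mdegMn mdeg1 mul1n. Qed.

(** Exponents of the single variable t are identified with natural numbers, which turns the Cauchy
    product in t into the convolution of the recurrence. *)
Lemma sum_bmultinom1 (V : zmodType) (c : multinom 1) (F : nat -> nat -> V) :
  \sum_(k : bmultinom 1 (mdeg c).+1 * bmultinom 1 (mdeg c).+1
     | c == mnm_add k.1 k.2) F (mdeg k.1) (mdeg k.2) =
  \sum_(0 <= j < (mdeg c).+1) F (mdeg c - j)%N j.
Proof.
set d := mdeg c; rewrite big_mkord.
have B_proof j : (j <= d)%N -> (mdeg (mnm_muln (mnm1 (@ord0 0)) j) < d.+1)%N.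
  by rewrite mdeg_mulmn1.
pose B j (jd : (j <= d)%N) : bmultinom 1 d.+1 := BMultinom (B_proof j jd).
rewrite (reindex (fun j : 'I_d.+1 => (B _ (leq_subr j d), B _ (leq_ord j)))).
  apply: eq_big => [j|j _] /=; last by rewrite !mdeg_mulmn1.
  apply/eqP/mdeg_inj1; rewrite mdeg_mnmD !mdeg_mulmn1 subnK //; exact: leq_ord.
exists (fun k : bmultinom 1 d.+1 * bmultinom 1 d.+1 => inord (mdeg k.2)) => [j
  _|[a b]] /=.
  by rewrite mdeg_mulmn1 inord_val.
rewrite unfold_in /= => /eqP cab.
have dab : d = (mdeg a + mdeg b)%N by rewrite -mdeg_mnmD -cab.
have da : (d - mdeg b)%N = mdeg a by rewrite -[RHS](addnK (mdeg b)) -dab.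
have bd : (mdeg b < d.+1)%N by rewrite bmdeg.
by congr (_, _); apply: val_inj; apply: mdeg_inj1;
  rewrite /= mdeg_mulmn1 inordK.
Qed.

(** * The generating series of the recurrence and its functional equation *)

Section Recurrence.
Variables (n : nat) (K : numFieldType) (H : 'cV[fps n K]_n).
Variable N : nat -> 'cV[fps n K]_n.
Hypothesis N1 : N 1%N = H.
Hypothesis NS : forall m : nat, (2 <= m)%N ->
  N m = fps_const (m.-1%:R^-1 : K) *:
        \sum_(1 <= k < m) jacobian (N k) *m N (m - k)%N.

Lemma recurrence_entry m i : (2 <= m)%N ->
  N m i 0 = fps_const (m.-1%:R^-1 : K) * \sum_(1 <= k < m)
    \sum_j fps_deriv j (N k i 0) * N (m - k)%N j 0.
Proof.
move=> m2; rewrite (NS m2) mxE summxE; congr (_ * _); apply: eq_bigr => k _.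
by rewrite mxE; apply: eq_bigr => j _; rewrite mxE.
Qed.

(** The derivative costs one degree, and (l r + 1 - 1) + ((k - l) r + 1) = k r + 1. The case r = 0
    shows that no N_[k] has a constant term; the case r = 1 makes the sum of the N_[k] finite in
    each degree. *)
Lemma recurrence_vanish r :
    (forall i m, (mdeg m < r.+1)%N -> fcoef (H i 0) m = 0) ->
  forall k i m, (0 < k)%N -> (mdeg m < (k * r).+1)%N -> fcoef (N k i 0) m = 0.
Proof.
move=> Hr k; elim/ltn_ind: k => k IHk i m k0 mk.
have [k2|] := ltnP 1 k; last first.
  by case: k k0 {IHk} mk => [|[|]] //; rewrite mul1n N1 => _ mk _; apply: Hr.
rewrite recurrence_entry // fcoefCM fcoef_sum big_nat big1 ?mulr0 //.
move=> l /andP[l0 lk]; rewrite fcoef_sum big1 // => j _.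
apply: (@fcoefM_vanish _ _ (l * r) ((k - l) * r).+1).
- move=> a al; rewrite fcoef_deriv IHk ?mul0rn //.
  by rewrite mdeg_mnmD mdeg1 addn1.
- by move=> a al; apply: IHk => //; rewrite ?subn_gt0 // ltn_subrL l0.
- by rewrite addnS -mulnDl subnKC // ltnW.
Qed.

Definition genfun : 'cV[fps n (fps 1 K)]_n :=
  \col_i Fps (fun m => Fps (fun c => fcoef (N (mdeg c).+1 i 0) m)).

Lemma tslice_genfun c i : tslice c (genfun i 0) = N (mdeg c).+1 i 0.
Proof. by rewrite mxE; apply: fpsP. Qed.

(** This is the recurrence itself, read in the coefficient of t^d with m = d + 2: differentiation in
    t produces the factor d + 1, which cancels 1 / (m - 1). *)
Lemma transport_genfun i : transport genfun (genfun i 0) = 0.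
Proof.
apply: fpsP => m; apply: fpsP => c.
suff : tslice c (transport genfun (genfun i 0)) = 0.
  exact: (congr1 (fun f => fcoef f m)).
rewrite tsliceB tslice_sum; apply/eqP; rewrite subr_eq0; apply/eqP.
set d := mdeg c.
have -> : tslice c (tderiv (genfun i 0)) = N d.+2 i 0 *+ d.+1.
  apply: fpsP => a; rewrite [LHS]/= mxE [fcoef _ _]/= mdeg_mnmD mdeg1 addn1.
  rewrite (_ : c ord0 = d); last by rewrite /d mdegE big_ord1.
  by move: (N _ i 0) => f; elim: d.+1 => // k IHk; rewrite !mulrS fcoefD IHk.
pose F a b : fps n K := \sum_j N a.+1 j 0 * fps_deriv j (N b.+1 i 0).
transitivity (\sum_(0 <= j < d.+1) F (d - j)%N j).
  rewrite recurrence_entry // -[fps_const _ * _ *+ _]mulr_natl mulrA.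
  rewrite -(rmorph_nat (@fps_const n K)) -rmorphM divff ?pnatr_eq0 //.
  rewrite rmorph1 mul1r big_add1 /=; apply: eq_big_nat => j /andP[_ jd].
  by rewrite /F; apply: eq_bigr => l _; rewrite mulrC subSS subSn.
rewrite -sum_bmultinom1 exchange_big; apply: eq_bigr => j _.
rewrite tsliceM; apply: eq_bigr => k _.
by rewrite tslice_deriv !tslice_genfun.
Qed.

Hypothesis H0 : no_const H.

Lemma genfun_no_const : no_const genfun.
Proof.
move=> i; rewrite mxE; apply: fpsP => c /=.
apply: (@recurrence_vanish 0) => //; last by rewrite mdeg0 muln0.
by move=> j m; rewrite ltnS leqn0 mdeg_eq0 => /eqP ->.
Qed.

Definition deformed_inverse : 'cV[fps n (fps 1 K)]_n :=
  fps_id + tvar *: genfun.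

Let U := deformed_inverse.

Lemma deformed_inverseE i : U i 0 = fps_X _ i + tvar * genfun i 0.
Proof. by rewrite /U !mxE. Qed.

Lemma deformed_inverse_no_const : no_const U.
Proof.
move=> i; rewrite deformed_inverseE fcoefD fcoefM0 genfun_no_const mulr0 addr0.
by have := @no_const_id n (fps 1 K) i; rewrite mxE.
Qed.

(* [transport genfun] is a derivation that kills the components of U, hence
   every series in them, and that kills [genfun]; it is injective on the series
   that vanish at t = 0. *)
Lemma genfun_fixpoint i : genfun i 0 = fps_subst (tconst (H i 0)) U.
Proof.
(* Since D z_j = - N_j, D t = 1 and D N_j = 0, the two contributions to D (z_j + t N_j) cancel. *)
have tU j : transport genfun (U j 0) = 0.
  rewrite deformed_inverseE raddfD /= transport_X transportM.
  rewrite transport_genfun mulr0 addr0 transport_const fps_derivX eqxx.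
  by rewrite rmorph1 mul1r addNr.
apply/eqP; rewrite -subr_eq0; apply/eqP; apply: (@transport_inj0 _ _ genfun).
  rewrite raddfB /= transport_genfun transport_subst ?subr0 //.
    exact: genfun_no_const.
  exact: deformed_inverse_no_const.
(* At t = 0 the series N becomes N_[1] = H and U becomes z; [rho] below is evaluation at t = 0. *)
rewrite tsliceB tslice_genfun mdeg0 N1; apply/eqP; rewrite subr_eq0 eq_sym.
apply/eqP; rewrite -[RHS]fps_subst_id; apply: fpsP => m.
pose rho (a : fps 1 K) (b : K) := fcoef a mnm0 = b.
have rhoP : subring_rel rho.
  by split; rewrite /rho ?fcoef1 ?eqxx // => a b _ _ <- <-; rewrite ?fcoefM0.
apply: (coef_rel_subst rhoP (d := (mdeg m).+1)) => //.
  by move=> k _; rewrite /rho /= eqxx.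
move=> j k _; rewrite /rho deformed_inverseE [RHS]/= !fcoefD fcoefCM fcoefM0.
rewrite [X in X * _]/= eq_sym mnm1_eq0 mul0r addr0 mxE /=.
by case: (k == _); rewrite ?fcoef1 ?eqxx.
Qed.

End Recurrence.

(** * Summation at t = 1 *)

Section Evaluation.
Local Open Scope classical_set_scope.
Variable K : numFieldType.
Implicit Types (a b p q : fps 1 K) (c s : K).

Definition partial_sum a (M : nat) : K^o :=
  \sum_(0 <= k < M) fcoef a (mnm_muln (mnm1 ord0) k).

(* The value at t = 1, as the sum of a possibly conditionally convergent
   series. *)
Definition cvg_at1 a s : Prop := partial_sum a @ \oo --> (s : K^o).

Lemma cvg_at1_unique a s s' : cvg_at1 a s -> cvg_at1 a s' -> s = s'.
Proof. move=> h h'; exact: (norm_cvg_unique h h'). Qed.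

Lemma cvg_at1B a b s s' : cvg_at1 a s -> cvg_at1 b s' -> cvg_at1 (a - b) (s -
  s').
Proof.
move=> h h'; rewrite /cvg_at1.
have -> : partial_sum (a - b) = partial_sum a - partial_sum b.
  apply/funext => M; rewrite -[RHS]/(partial_sum a M - partial_sum b M).
  by rewrite /partial_sum -sumrB.
exact: cvgB.
Qed.

Lemma cvg_at1D a b s s' : cvg_at1 a s -> cvg_at1 b s' -> cvg_at1 (a + b) (s +
  s').
Proof.
move=> h h'; rewrite /cvg_at1.
have -> : partial_sum (a + b) = partial_sum a + partial_sum b.
  apply/funext => M; rewrite -[RHS]/(partial_sum a M + partial_sum b M).
  by rewrite /partial_sum -big_split.
exact: cvgD.
Qed.

Lemma cvg_at1_constM c a s : cvg_at1 a s -> cvg_at1 (fps_const c * a) (c * s).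
Proof.
move=> h; rewrite /cvg_at1.
have -> : partial_sum (fps_const c * a) = (fun M => c *: partial_sum a M).
  apply/funext => M; rewrite /partial_sum scaler_sumr.
  by apply: eq_bigr => k _; rewrite fcoefCM.
exact: cvgZl_tmp.
Qed.

Lemma fcoefXM (n : nat) (i : 'I_n) (f : fps n K) m :
  fcoef (fps_X K i * f) (mnm_add m (mnm1 i)) = fcoef f m.
Proof.
set k := mnm_add _ _; pose d := mdeg k; rewrite [LHS](@fcoef_mul _ _ d) //.
rewrite (@mcoeff_mul_eq _ _ d _ _ (mpolyX K (mnm1 i)) (fps_trunc d f)) //.
  rewrite mulrC /k mnm_addC mcoeffMX mcoeff_trunc //.
  by rewrite /d /k mdeg_mnmD leq_addr.
by move=> l ld; rewrite mcoeff_trunc //= mcoeffX eq_sym.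
Qed.

(** Multiplication by t shifts the partial sums by one place. *)
Lemma cvg_at1_XM a s : cvg_at1 a s -> cvg_at1 (fps_X K ord0 * a) s.
Proof.
move=> h; rewrite /cvg_at1 -cvg_shiftS.
suff -> : [sequence partial_sum (fps_X K ord0 * a) M.+1]_M = partial_sum a by
  [].
apply/funext => M; rewrite -[LHS]/(partial_sum _ M.+1) /partial_sum.
rewrite big_nat_recl // (_ : mnm_muln _ 0 = mnm0); last first.
  by apply: mdeg_inj1; rewrite mdeg_mulmn1.
rewrite fcoefM0 [X in X * _]/= eq_sym mnm1_eq0 mul0r add0r.
apply: eq_bigr => k _; rewrite -[RHS](@fcoefXM 1 ord0); congr (fcoef _ _).
by apply: mdeg_inj1; rewrite mdeg_mnmD !mdeg_mulmn1 mdeg1 addn1.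
Qed.

Lemma cvg_at1_0 : cvg_at1 0 0.
Proof. by apply: cvg_near_cst; apply: nearW => M;
  rewrite /partial_sum big1. Qed.

Lemma cvg_at1_1 : cvg_at1 1 1.
Proof.
apply: cvg_near_cst; near=> M; rewrite /partial_sum -(ltn_predK (_ :
  (0 < M)%N)); last first.
  by near: M; exists 1%N.
rewrite big_nat_recl // fcoef1 -mdeg_eq0 mdeg_mulmn1 eqxx big1 ?addr0 // => k _.
by rewrite fcoef1 -mdeg_eq0 mdeg_mulmn1.
Unshelve. all: by end_near. Qed.

(** A product of two conditionally convergent series need not converge. Multipliers are the series
    for which the product with any convergent series does, with the expected sum; constants and t
    are multipliers, hence so are polynomials in t. *)
Definition multiplier q c : Prop :=
  forall a s, cvg_at1 a s -> cvg_at1 (q * a) (c * s).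

Lemma multiplier_subring : subring_rel multiplier.
Proof.
split=> [a s|p q c d hp hq a s h|p q c d hp hq a s h].
- by rewrite !mul1r.
- by rewrite !mulrBl; apply: cvg_at1B; [apply: hp | apply: hq].
- by rewrite -!mulrA; apply/hp/hq.
Qed.

Lemma multiplier_const c : multiplier (fps_const c) c.
Proof. by move=> a s; apply: cvg_at1_constM. Qed.

Lemma multiplier_X : multiplier (fps_X K ord0) 1.
Proof. by move=> a s; rewrite mul1r; apply: cvg_at1_XM. Qed.

Lemma multiplier_cvg q c : multiplier q c -> cvg_at1 q c.
Proof. by move=> /(_ _ _ cvg_at1_1); rewrite !mulr1. Qed.

(* [rational_at1 a s] expresses that a is the quotient of two multipliers of
   values c * s and c with c <> 0. Unlike [cvg_at1], it is stable under
   products; it determines the value of [cvg_at1]. *)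
Definition rational_at1 a s : Prop :=
  exists q c, [/\ c != 0, multiplier q c & multiplier (q * a) (c * s)].

Lemma multiplier_rational q c : multiplier q c -> rational_at1 q c.
Proof.
by exists 1, 1; rewrite !mul1r; split=> //; apply: (rel1 multiplier_subring).
Qed.

Lemma rational_at1_subring : subring_rel rational_at1.
Proof.
have mB := relB multiplier_subring; have mM := relM multiplier_subring.
split=> [|a b s t|a b s t]; first exact/multiplier_rational/(rel1
  multiplier_subring).
- case=> [p [c [c0 pc pa]]] [q [d [d0 qd qb]]]; exists (p * q), (c * d).
  rewrite mulf_neq0 // !mulrBr [p * q * a]mulrAC [c * d * s]mulrAC -!(mulrA _
    q b).
  by rewrite -(mulrA c d t); split=> //; [apply: mM | apply: mB; apply: mM].
- case=> [p [c [c0 pc pa]]] [q [d [d0 qd qb]]]; exists (p * q), (c * d).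
  by rewrite mulf_neq0 // mulrACA [c * d * _]mulrACA; split=> //; apply: mM.
Qed.

Lemma rational_at1_div q c a s : c != 0 -> multiplier q c ->
  rational_at1 (q * a) (c * s) -> rational_at1 a s.
Proof.
move=> c0 qc [p [d [d0 pd pqa]]]; exists (p * q), (d * c).
rewrite mulf_neq0 // -!mulrA; split=> //; exact: (relM multiplier_subring).
Qed.

(** The series q * a has sum c * s as a multiplier, and sum c * s' as the product of the multiplier
    q with the convergent series a; the nonzero c cancels. *)
Lemma rational_at1_cvg a s s' : rational_at1 a s -> cvg_at1 a s' -> s = s'.
Proof.
move=> [q [c [c0 qc /multiplier_cvg qa]]] /qc qa'.
exact: (mulfI c0 (cvg_at1_unique qa qa')).
Qed.

End Evaluation.

(** * Uniqueness for the equation F(V) = F(W), and left inverses *)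

Lemma fps_comp_subl (n : nat) (K : comNzRingType) (H V : 'cV[fps n K]_n) :
  no_const V -> fps_comp (fps_id - H) V = V - fps_comp H V.
Proof.
by move=> V0; apply/colP => i; rewrite !mxE fps_substB fps_subst_X.
Qed.

Lemma fcoef_subst_linear_part (n : nat) (K : comNzRingType) (f : fps n K)
    (g : 'cV[fps n K]_n) m : no_const g -> fcoef f mnm0 = 0 ->
  fcoef (fps_subst f g) m = \sum_j fcoef f (mnm1 j) * fcoef (g j 0) m
                            + fcoef (fps_subst (fps_nonlinear f) g) m.
Proof.
move=> g0 f0; rewrite fps_subst_linear_part // fcoefD fcoef_sum.
by congr (_ + _); apply: eq_bigr => j _; rewrite fcoefCM.
Qed.

Definition linear_part (n : nat) (K : comNzRingType) (H : 'cV[fps n K]_n)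
  : 'M[K]_n := \matrix_(i, j) fcoef (H i 0) (mnm1 j).

Lemma sub_linear_partE (n : nat) (K : comNzRingType) (H : 'cV[fps n K]_n)
    (x : 'I_n -> K) i :
  \sum_j (1%:M - linear_part H) i j * x j =
  x i - \sum_j fcoef (H i 0) (mnm1 j) * x j.
Proof.
under eq_bigr do rewrite !mxE mulrBl.
rewrite sumrB (bigD1 i) //= eqxx mul1r big1 ?addr0 // => j ji.
by rewrite eq_sym (negbTE ji) mul0r.
Qed.

Section Inverse.
Variables (n : nat) (K : comUnitRingType) (H : 'cV[fps n K]_n).
Hypothesis H0 : no_const H.
Hypothesis uH : 1%:M - linear_part H \in unitmx.

(** Induction on the degree: once V and W agree in lower degrees, their nonlinear contributions in
    the current degree agree, so the difference x of their coefficients satisfies (I - A) x = 0. *)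
Lemma fps_sub_comp_inj (V W : 'cV[fps n K]_n) : no_const V -> no_const W ->
  V - fps_comp H V = W - fps_comp H W -> V = W.
Proof.
move=> V0 W0 VW; suff h d i : coef_rel eq d (V i 0) (W i 0).
  by apply/colP => i; apply: fpsP => m; apply: (h (mdeg m).+1).
elim: d i => // d IHd i m md.
pose x j := fcoef (V j 0) m - fcoef (W j 0) m.
have xK : (1%:M - linear_part H) *m \col_j x j = 0.
  apply/colP => k; rewrite !mxE.
  under eq_bigr do rewrite [(\col__ _) _ _]mxE.
  rewrite sub_linear_partE /x; under eq_bigr do rewrite mulrBr.
  rewrite sumrB.
  have e : fcoef (V k 0) m - fcoef (fps_subst (H k 0) V) m =
           fcoef (W k 0) m - fcoef (fps_subst (H k 0) W) m.
    have /colP /(_ k) := VW; rewrite !mxE.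
    exact: (congr1 (fun f => fcoef f m)).
  rewrite (fcoef_subst_linear_part _ V0 (H0 k)) in e.
  rewrite (fcoef_subst_linear_part _ W0 (H0 k)) in e.
  have nl := coef_rel_subst_nonlinear (eq_subring_rel K) (f :=
    H k 0) (fun=> erefl) V0 W0 IHd md.
  rewrite {}nl in e.
  move: (\sum_j _) (\sum_j _) (fcoef (fps_subst _ _) _) e => a b c e.
  have -> : fcoef (V k 0) m - fcoef (W k 0) m - (b - a) =
    fcoef (V k 0) m - (b + c) - (fcoef (W k 0) m - (a + c)) by ring.
  by rewrite e subrr.
have /colP /(_ i) : \col_j x j = 0 by rewrite -(mulKmx uH (\col_j x j)) xK
  mulmx0.
by rewrite !mxE => /eqP; rewrite subr_eq0 => /eqP.
Qed.

(** By associativity F(V(F)) = F = F(z), and [fps_sub_comp_inj] cancels the outer F. *)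
Lemma fps_left_inverse (V : 'cV[fps n K]_n) : no_const V ->
  fps_comp (fps_id - H) V = fps_id -> fps_comp V (fps_id - H) = fps_id.
Proof.
move=> V0 FV; have F0 : no_const (fps_id - H).
  by move=> i; rewrite mxE fcoefD no_const_id add0r mxE fcoefN H0 oppr0.
have W0 := no_const_comp V0 F0.
apply: fps_sub_comp_inj => //; first exact: no_const_id.
by rewrite fps_comp_id -fps_comp_subl // -fps_compA // FV fps_comp_idl.
Qed.

End Inverse.

(** * Specialization of the functional equation at t = 1 *)

Section SumOfRecurrence.
Variables (n : nat) (K : numFieldType) (H : 'cV[fps n K]_n).
Variable N : nat -> 'cV[fps n K]_n.
Hypothesis N1 : N 1%N = H.
Hypothesis NS : forall m : nat, (2 <= m)%N ->
  N m = fps_const (m.-1%:R^-1 : K) *: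
        \sum_(1 <= k < m) jacobian (N k) *m N (m - k)%N.
Hypothesis H0 : no_const H.
Variable S : 'cV[fps n K]_n.
Hypothesis cvgS :
  forall i m, cvg_at1 (fcoef (genfun N i 0) m) (fcoef (S i 0) m).

Let U := deformed_inverse N.
Let V := fps_id + S.
Let A := linear_part H.
(** The matrix I - tA, whose entries are multipliers with the entries of I - A as values. *)
Let B : 'M[fps 1 K]_n :=
  \matrix_(i, j) ((i == j)%:R - fps_X K ord0 * fps_const (A i j)).
Let L i := fps_nonlinear (tconst (H i 0)).

Let U0 : no_const U := deformed_inverse_no_const N1 NS H0.

Lemma multiplier_bool (b : bool) : multiplier (b%:R : fps 1 K) b%:R.
Proof.
by case: b; [apply: (rel1 (multiplier_subring K)) | apply: (rel0
  (multiplier_subring K))].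
Qed.

Lemma multiplier_B i j : multiplier (B i j) ((1%:M - A) i j).
Proof.
have -> : (1%:M - A) i j = (i == j)%:R - A i j by rewrite !mxE.
rewrite [B i j]mxE.
apply: (relB (multiplier_subring K)); first exact: multiplier_bool.
have := relM (multiplier_subring K) (@multiplier_X K) (@multiplier_const K (A
  i j)).
by rewrite mul1r.
Qed.

Lemma cvg_deformed_inverse i m : cvg_at1 (fcoef (U i 0) m) (fcoef (V i 0) m).
Proof.
rewrite /U deformed_inverseE /V !mxE !fcoefD fcoefCM; apply: cvg_at1D.
  by apply: multiplier_cvg; apply: multiplier_bool.
by apply: cvg_at1_XM; have := @cvgS i m; rewrite mxE.
Qed.

(** The coefficient of z^m in U = z + t H(U), with the linear term t A U moved to the left. *)
Lemma deformed_linear_system i m :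
  \sum_j B i j * fcoef (U j 0) m =
  (m == mnm1 i)%:R + fps_X K ord0 * fcoef (fps_subst (L i) U) m.
Proof.
have E : fcoef (U i 0) m = (m == mnm1 i)%:R + fps_X K ord0 *
   (\sum_j fps_const (A i j) * fcoef (U j 0) m + fcoef (fps_subst (L i) U) m).
  rewrite {1}/U deformed_inverseE (genfun_fixpoint N1 NS H0) fcoefD fcoefCM.
  rewrite fcoef_subst_linear_part //; last by rewrite /= H0 raddf0.
  by congr (_ + _ * (_ + _)); apply: eq_bigr => j _; rewrite [A i j]mxE.
under eq_bigr do rewrite mxE mulrBl -mulrA.
rewrite sumrB -mulr_sumr (bigD1 i) //= eqxx mul1r big1 ?addr0; last first.
  by move=> j ji; rewrite eq_sym (negbTE ji) mul0r.
by rewrite E mulrDr addrA addrAC addrK.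
Qed.

Lemma cvg_at1_sum (I : Type) (r : seq I) (F : I -> fps 1 K) (G : I -> K) :
  (forall i, cvg_at1 (F i) (G i)) ->
  cvg_at1 (\sum_(i <- r) F i) (\sum_(i <- r) G i).
Proof.
move=> FG; apply: (big_ind2 (@cvg_at1 K)) => //; first exact: cvg_at1_0.
by move=> *; apply: cvg_at1D.
Qed.

(** Convergence forces invertibility: in degree 1 the system reads (I - tA) X_t = I, and summation
    at t = 1 yields (I - A) X = I with X the linear part of V. *)
Lemma sub_linear_part_unit : 1%:M - A \in unitmx.
Proof.
pose X : 'M[K]_n := \matrix_(j, l) fcoef (V j 0) (mnm1 l).
suff /mulmx1_unit[] : (1%:M - A) *m X = 1%:M by [].
apply/matrixP => i l; rewrite !mxE.
apply: (@cvg_at1_unique _ (\sum_j B i j * fcoef (U j 0) (mnm1 l))).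
  apply: cvg_at1_sum => j; rewrite [X j l]mxE; apply: multiplier_B.
  exact: cvg_deformed_inverse.
rewrite deformed_linear_system (_ : fcoef _ _ = 0) ?mulr0 ?addr0.
  by rewrite eq_mnm1 eq_sym; apply: multiplier_cvg; apply: multiplier_bool.
rewrite fcoef_subst big1 // => a _ /=.
have -> : (mdeg a < 2)%N by apply: leq_trans (bmdeg a) _; rewrite mdeg1.
by rewrite mul0r.
Qed.

Lemma sum_no_const : no_const V.
Proof.
move=> i; have := @cvg_deformed_inverse i mnm0; rewrite (U0 i) => h.
exact: (cvg_at1_unique h (@cvg_at1_0 K)).
Qed.

(** Cramer's rule, by induction on the degree: det(I - tA) times a coefficient of U is a
    combination, with entries of the adjugate of I - tA, of right-hand sides that are rational
    because they involve only lower degrees of U. *)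
Lemma rational_deformed_inverse d i :
  coef_rel (@rational_at1 K) d (U i 0) (V i 0).
Proof.
have ratP := rational_at1_subring K.
elim: d i => // d IHd i m md.
pose x j := fcoef (U j 0) m; pose y j := \sum_k B j k * x k.
pose y' j := (m == mnm1 j)%:R + 1 * fcoef (fps_subst (fps_nonlinear (H j 0))
  V) m.
have yy' j : rational_at1 (y j) (y' j).
  rewrite /y deformed_linear_system; apply: (relD ratP).
    by apply: multiplier_rational; apply: multiplier_bool.
  apply: (relM ratP); first by apply: multiplier_rational; apply: multiplier_X.
  apply: (coef_rel_subst_nonlinear ratP) IHd _ md => //.
    by move=> k; apply: multiplier_rational; apply: multiplier_const.
  exact: sum_no_const.
have detE : \det B * x i = \sum_j \adj B i j * y j.
  have := mul_adj_mx B => /(congr1 (fun M => (M *m \col_j x j) i 0)).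
  rewrite -mulmxA mul_scalar_mx !mxE => <-; apply: eq_bigr => j _.
  by rewrite !mxE; congr (_ * _); apply: eq_bigr => k _; rewrite !mxE.
have dB : \det (1%:M - A) != 0 by rewrite -unitfE -unitmxE sub_linear_part_unit.
pose s := \sum_j \adj (1%:M - A) i j * y' j.
have ratx : rational_at1 (x i) (s / \det (1%:M - A)).
  apply: (rational_at1_div dB (rel_det (multiplier_subring K) multiplier_B)).
  rewrite detE mulrC divfK //; apply: rel_sum => // j _;
    apply: (relM ratP) => //.
  by apply: multiplier_rational; apply: rel_adj => //;
    [apply: multiplier_subring | apply: multiplier_B].
(* The value given by Cramer's rule is the coefficient of V, because the series is known to converge
   to the latter. *)
by rewrite -(rational_at1_cvg ratx (@cvg_deformed_inverse i m)).
Qed.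

(** The identity z = U - t H(U) is evaluated at t = 1 by [rational_at1], which is compatible with
    substitution; the value of the left side is known by convergence. *)
Lemma sum_right_inverse : fps_comp (fps_id - H) V = fps_id.
Proof.
rewrite fps_comp_subl; last exact: sum_no_const.
have ratP := rational_at1_subring K.
apply/colP => i; apply: fpsP => m.
apply: (@rational_at1_cvg _ (fcoef (fps_X (fps 1 K) i) m)); last first.
  rewrite mxE; apply: multiplier_cvg; exact: multiplier_bool.
have -> : fcoef (fps_X (fps 1 K) i) m = fcoef (U i 0) m -
    fps_X K ord0 * fcoef (fps_subst (tconst (H i 0)) U) m.
  by rewrite /U deformed_inverseE (genfun_fixpoint N1 NS H0) fcoefD fcoefCM
    addrK.
rewrite !mxE fcoefB; apply: (relB ratP).
  by have := rational_deformed_inverse i (ltnSn (mdeg m)); rewrite !mxE.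
rewrite -[X in rational_at1 _ X]mul1r; apply: (relM ratP).
  by apply: multiplier_rational; apply: multiplier_X.
apply: (coef_rel_subst ratP (d := (mdeg m).+1)) => //.
  by move=> k _; apply: multiplier_rational; apply: multiplier_const.
by move=> j; apply: rational_deformed_inverse.
Qed.

Lemma sum_left_inverse : fps_comp V (fps_id - H) = fps_id.
Proof.
apply: fps_left_inverse => //; first exact: sub_linear_part_unit.
  exact: sum_no_const.
exact: sum_right_inverse.
Qed.

End SumOfRecurrence.

(** * Orders, modes of summation, and conclusion *)

Section Orders.
Variables (R : realType) (n : nat).
Implicit Types U : 'cV[fps n R[i]]_n.

Lemma fps_order_geP k (f : fps n R[i]) :
  (k%:R%:E <= fps_order f)%E <->
  (forall m, (mdeg m < k)%N -> fcoef f m = 0).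
Proof.
split=> [kf m mk|f0]; last first.
  apply: le_ereal_inf_tmp => _ [m /= fm <-]; rewrite lee_fin ler_nat leqNgt.
  by apply: contra_neqN fm => /f0.
apply/eqP; apply: contraTT kf => fm; rewrite -ltNge.
apply: (@le_lt_trans _ _ (mdeg m)%:R%:E); last by rewrite lte_fin ltr_nat.
by apply: ereal_inf_lbound; exists m.
Qed.

Lemma vec_order_geP k U :
  (k%:R%:E <= vec_order U)%E <->
  (forall i m, (mdeg m < k)%N -> fcoef (U i 0) m = 0).
Proof.
split=> [/Order.TotalTheory.bigmin_geP[_ kU] i|U0].
  by apply/fps_order_geP; apply: kU.
apply/Order.TotalTheory.bigmin_geP; split=> [|i _]; first exact: leey.
by apply/fps_order_geP; apply: U0.
Qed.

Lemma vec_order_ge1P U : (1 <= vec_order U)%E <-> no_const U.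
Proof.
split=> [/(vec_order_geP 1) U0 i|U0]; first by apply: U0; rewrite mdeg0.
apply/(vec_order_geP 1) => i m.
by rewrite ltnS leqn0 mdeg_eq0 => /eqP ->; apply: U0.
Qed.

Lemma is_formal_sum_is_sum (N : nat -> 'cV[fps n R[i]]_n) S :
  is_formal_sum N S -> is_sum N S.
Proof. by move=> NS i m; apply: cvg_near_cst; apply: NS. Qed.

Lemma is_sum_genfun (N : nat -> 'cV[fps n R[i]]_n) S : is_sum N S ->
  forall i m, cvg_at1 (fcoef (genfun N i 0) m) (fcoef (S i 0) m).
Proof.
(* The index shift turns the sum over 1 <= k < M + 1 into the partial sum over 0 <= k < M of the
   series in t, whose coefficient at t^k comes from N_[k+1]. *)
move=> NS i m; have := NS i m; rewrite -cvg_shiftS /cvg_at1.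
set u := (X in cvg_to (nbhs (fmap X _))).
suff -> : partial_sum (fcoef (genfun N i 0) m) = u by [].
apply/funext => M.
rewrite /partial_sum /u /= summxE fcoef_sum big_add1 /=.
by apply: eq_bigr => k _; rewrite mxE /= mdeg_mulmn1.
Qed.

End Orders.

(** The two clauses reflect the meaning of the infinite sum. For o(H) >= 2 it is finite in each
    degree. For o(H) = 1 it may diverge, as for n = 1 and H = z, where every N_[m] is z and F = 0;
    there the formula is asserted whenever the coefficients converge. *)
Theorem theorem2p7 (R : realType) (n : nat) (n_ge1 : (1 <= n)%N)
    (H : 'cV[fps n R[i]]_n) (oH : (1 <= vec_order H)%E)
    (N : nat -> 'cV[fps n R[i]]_n)
    (N1 : N 1%N = H)
    (NS : forall m : nat, (2 <= m)%N ->
       N m = fps_const (m.-1%:R^-1 : R[i]) *: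
             \sum_(1 <= k < m) jacobian (N k) *m N (m - k)%N) :
  ((2 <= vec_order H)%E -> exists2 S, is_formal_sum N S &
     is_formal_inverse (fps_id - H) (fps_id + S)) /\
  (forall S, is_sum N S -> is_formal_inverse (fps_id - H) (fps_id + S)).
Proof.
have H0 : no_const H by apply/vec_order_ge1P.
have inv S : is_sum N S -> is_formal_inverse (fps_id - H) (fps_id + S).
  move=> /is_sum_genfun cvgS; split.
  - apply/vec_order_ge1P => i; rewrite mxE fcoefD no_const_id add0r mxE fcoefN.
    by rewrite H0 oppr0.
  - by apply/vec_order_ge1P; apply: (sum_no_const N1 NS H0).
  - exact: (sum_right_inverse N1 NS H0).
  - exact: (sum_left_inverse N1 NS H0).
split=> // /(vec_order_geP 2) H2.
(* Here N_[k] has order at least k + 1, so that z^m occurs only in those with k < mdeg m, and the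
   truncated sum already contains all of them. *)
pose S : 'cV[fps n R[i]]_n := \col_i Fps (fun m =>
  fcoef ((\sum_(1 <= k < (mdeg m).+1) N k) i 0) m).
have sumS : is_formal_sum N S; last first.
  by exists S => //; apply/inv/is_formal_sum_is_sum.
move=> i m; exists (mdeg m).+1 => // M /= mM.
rewrite mxE /= (@big_cat_nat _ _ _ (mdeg m).+1) //= mxE fcoefD.
rewrite [X in _ + X](_ : _ = 0) ?addr0 // summxE fcoef_sum big_nat big1 //.
move=> k /andP[mk _]; apply: (recurrence_vanish N1 NS (r := 1)) => //.
  exact: leq_trans mk.
by rewrite muln1 leqW.
Qed.
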